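(* Let $b\in\mathbb{R}^n$ and let $T\in\mathbb{R}^{n\times n}$ be a symmetric and positive definite matrix. Then the equation $$P_{\mathcal K}(x)+Tx=b,\qquad x\in\mathbb{R}^n,$$ has a unique solution $x^*\in\mathbb{R}^n$ and, for any starting point $x^0\in\mathbb{R}^n$, the semi-smooth Newton sequence $\{x^k\}$ generated by $$[V(x^k)+T]\,x^{k+1}=b,\qquad V(x^k)\in\partial_B P_{\mathcal K}(x^k),\qquad k=0,1,\ldots,$$ is well-defined. Moreover, if $\|T^{-1}\|<1$, then $\{x^k\}$ converges $Q$-linearly to $x^*$ as follows: $$\|x^*-x^{k+1}\|\le \|T^{-1}\|\,\|x^*-x^k\|,\qquad k=0,1,\ldots.$$
   Context: $\mathbb{R}^n$ carries the canonical inner product and Euclidean norm $\|\cdot\|$; for a matrix $E\in\mathbb{R}^{n\times n}$, $\|E\|=\max\{\|Ex\|: \|x\|=1\}$. $\mathcal K=\{x=(x_1,x_2)\in\mathbb{R}\times\mathbb{R}^{n-1}: \|x_2\|\le x_1\}$ is the second order cone and $P_{\mathcal K}$ is the Euclidean metric projection onto $\mathcal K$. For a locally Lipschitz map $F:\mathbb{R}^n\to\mathbb{R}^m$, with $D_F$ the set of points where $F$ is differentiable and $F'$ its Jacobian, the B-subdifferential is $\partial_BF(x)=\{V\in\mathbb{R}^{m\times n}: \exists\,\{x^k\}\subset D_F,\ x^k\to x,\ F'(x^k)\to V\}$. In the Newton iteration $V(x^k)$ is an arbitrary element of $\partial_BP_{\mathcal K}(x^k)$; ''well-defined'' means that the linear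 system at each step has a nonsingular matrix, so that $x^{k+1}$ exists and is unique, whatever the choice of $V(x^k)$. *)

(* Defs.v *)
From mathcomp Require Import all_boot all_order all_algebra.
From mathcomp Require Import all_classical all_reals all_analysis.

Set Implicit Arguments.
Unset Strict Implicit.
Unset Printing Implicit Defensive.

Import Order.TTheory GRing.Theory Num.Theory.
Import numFieldNormedType.Exports.

Local Open Scope classical_set_scope.
Local Open Scope ring_scope.

(* Vectors of R^n are columns 'cV[R]_n.  The library's norm `|x| on matrices is
   the max norm, hence the Euclidean norm below; the topology and the notion of
   differentiability are the same for both norms. *)

Definition dotp (R : realType) (n : nat) (x y : 'cV[R]_n) : R :=
  (x^T *m y) ord0 ord0.

Definition enorm (R : realType) (n : nat) (x : 'cV[R]_n) : R :=
  Num.sqrt (dotp x x).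

(* For n > 0 the unit sphere is nonempty and compact, so this sup is a max. *)
Definition opnorm (R : realType) (n : nat) (E : 'M[R]_n) : R :=
  sup [set enorm (E *m x) | x in [set x : 'cV[R]_n | enorm x = 1]].

Definition sym_mx (R : realType) (n : nat) (T : 'M[R]_n) : Prop := T^T = T.

Definition posdef_mx (R : realType) (n : nat) (T : 'M[R]_n) : Prop :=
  forall x : 'cV[R]_n, x != 0 -> 0 < dotp x (T *m x).

(* R^(m+1) = R x R^m: the entry at index 0 is x_1, the remaining block is x_2. *)
Definition soc (R : realType) (m : nat) : set 'cV[R]_m.+1 :=
  [set x | enorm (dsubmx (x : 'cV[R]_(1 + m))) <= x ord0 ord0].

Definition is_proj (R : realType) (n : nat) (A : set 'cV[R]_n)
    (x p : 'cV[R]_n) : Prop :=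
  A p /\ forall y, A y -> enorm (x - p) <= enorm (x - y).

(* The value is unique when A is nonempty, closed and convex. *)
Definition mproj (R : realType) (n : nat) (A : set 'cV[R]_n)
    (x : 'cV[R]_n) : 'cV[R]_n :=
  [get p | is_proj A x p].

(* The library's [jacobian] is for row vectors (it acts on the right); this is
   its analogue for columns: jacobian_mx F x *m v = 'd F x v. *)
Definition jacobian_mx (R : realType) (m n : nat)
    (F : 'cV[R]_n -> 'cV[R]_m) (x : 'cV[R]_n) : 'M[R]_(m, n) :=
  \matrix_(i < m, j < n) ('d F x (delta_mx j ord0) : 'cV[R]_m) i ord0.

Definition bsubdiff (R : realType) (m n : nat)
    (F : 'cV[R]_n -> 'cV[R]_m) (x : 'cV[R]_n) : set 'M[R]_(m, n) :=
  [set V | exists u : nat -> 'cV[R]_n,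
    [/\ forall k, differentiable F (u k),
        u @ \oo --> x &
        (fun k => jacobian_mx F (u k)) @ \oo --> V]].

Definition newton_step (R : realType) (m : nat) (T : 'M[R]_m.+1)
    (b x y : 'cV[R]_m.+1) : Prop :=
  exists2 V, bsubdiff (mproj (@soc R m)) x V & (V + T) *m y = b.

Definition newton_run (R : realType) (m : nat) (T : 'M[R]_m.+1)
    (b x0 : 'cV[R]_m.+1) (N : nat) (x : nat -> 'cV[R]_m.+1) : Prop :=
  x 0%N = x0 /\ forall k, (k < N)%N -> newton_step T b (x k) (x k.+1).

(* However the first N steps were performed, a matrix V(x^N) is available and,
   for every choice of it, the next linear system is nonsingular. *)
Definition newton_well_defined (R : realType) (m : nat) (T : 'M[R]_m.+1)
    (b x0 : 'cV[R]_m.+1) : Prop :=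
  forall (N : nat) (x : nat -> 'cV[R]_m.+1), newton_run T b x0 N x ->
    bsubdiff (mproj (@soc R m)) (x N) !=set0 /\
    forall V, bsubdiff (mproj (@soc R m)) (x N) V -> V + T \in unitmx.

Definition newton_seq (R : realType) (m : nat) (T : 'M[R]_m.+1)
    (b x0 : 'cV[R]_m.+1) (x : nat -> 'cV[R]_m.+1) : Prop :=
  x 0%N = x0 /\ forall k, newton_step T b (x k) (x k.+1).

(* Main.v *)
(* The projection P onto the cone is firmly nonexpansive and positively
   homogeneous.  Both properties pass to Jacobians and then to their limits, so
   every V in the B-subdifferential of P at x satisfies |Vv|^2 <= <Vv, v> and
   V x = P x.  Hence V + T is positive definite, and for a solution xs
     (V + T)(xs - y) = V (xs - x) - (P xs - P x)
   for the Newton successor y of x.  With d = xs - x, both terms on the right lie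
   in the ball having [0, d] as a diameter, so the right-hand side has norm at
   most |d|; and |e|^2 <= |T^-1| <e, T e> by Cauchy-Schwarz for the form of T.

   For existence, x solves the equation iff p = P x minimizes
   <p, (1 + T^-1) p> / 2 - <T^-1 b, p> over the cone and x = T^-1 (b - p); this
   form is coercive and the cone is closed.

   The B-subdifferential is nonempty because P is locally the identity or zero
   near points pushed along the axis from the cone or its polar, and is given by
   a smooth formula elsewhere. *)
Require Import Defs.
From mathcomp Require Import all_boot all_order all_algebra.
From mathcomp Require Import all_classical all_reals all_analysis.
From mathcomp Require Import ring lra.

Set Implicit Arguments.
Unset Strict Implicit.
Unset Printing Implicit Defensive.

Import Order.TTheory GRing.Theory Num.Theory.
Import numFieldNormedType.Exports.

Local Open Scope classical_set_scope.
Local Open Scope ring_scope.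

(** * Euclidean inner product and norm, positive definite matrices *)

Section Euclidean.
Variables (R : realType) (n : nat).
Implicit Types (x y z : 'cV[R]_n) (a : R) (M : 'M[R]_n).

Lemma dotpE x y : dotp x y = \sum_i x i ord0 * y i ord0.
Proof. by rewrite /dotp mxE; apply: eq_bigr => i _; rewrite mxE. Qed.

Lemma dotpC x y : dotp x y = dotp y x.
Proof. by rewrite !dotpE; apply: eq_bigr => i _; rewrite mulrC. Qed.

Lemma dotpDr x y z : dotp x (y + z) = dotp x y + dotp x z.
Proof. by rewrite /dotp mulmxDr mxE. Qed.

Lemma dotpZr a x y : dotp x (a *: y) = a * dotp x y.
Proof. by rewrite /dotp -scalemxAr mxE. Qed.

Lemma dotpNr x y : dotp x (- y) = - dotp x y.
Proof. by rewrite /dotp mulmxN mxE. Qed.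

Lemma dotpDl x y z : dotp (x + y) z = dotp x z + dotp y z.
Proof. by rewrite ![dotp _ z]dotpC dotpDr. Qed.

Lemma dotpZl a x y : dotp (a *: x) y = a * dotp x y.
Proof. by rewrite ![dotp _ y]dotpC dotpZr. Qed.

Lemma dotpNl x y : dotp (- x) y = - dotp x y.
Proof. by rewrite ![dotp _ y]dotpC dotpNr. Qed.

Lemma dotp0r x : dotp x 0 = 0.
Proof. by rewrite /dotp mulmx0 mxE. Qed.

Lemma dotp0l x : dotp 0 x = 0.
Proof. by rewrite dotpC dotp0r. Qed.

Definition dotp_lin := (dotpDl, dotpDr, dotpNl, dotpNr, dotpZl, dotpZr).

Lemma dotp_ge0 x : 0 <= dotp x x.
Proof. by rewrite dotpE; apply: sumr_ge0 => i _; rewrite -expr2 sqr_ge0. Qed.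

Lemma dotp_coord_le x i : x i ord0 ^+ 2 <= dotp x x.
Proof.
rewrite dotpE (bigD1 i) //= expr2 lerDl.
by apply: sumr_ge0 => j _; rewrite -expr2 sqr_ge0.
Qed.

Lemma dotp_eq0 x : (dotp x x == 0) = (x == 0).
Proof.
apply/idP/eqP => [/eqP x0|->]; last by rewrite dotp0r.
apply/matrixP => i j; rewrite ord1 mxE; apply/eqP.
by rewrite -sqrf_eq0 eq_le sqr_ge0 andbT -x0 dotp_coord_le.
Qed.

Lemma dotp_gt0 x : x != 0 -> 0 < dotp x x.
Proof. by move=> x0; rewrite lt_def dotp_eq0 x0 dotp_ge0. Qed.

Lemma dotp_mulmxl M x y : dotp (M *m x) y = dotp x (M^T *m y).
Proof. by rewrite /dotp trmx_mul mulmxA. Qed.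

Lemma enorm_ge0 x : 0 <= enorm x.
Proof. exact: sqrtr_ge0. Qed.

Lemma enorm_sqr x : enorm x ^+ 2 = dotp x x.
Proof. by rewrite sqr_sqrtr // dotp_ge0. Qed.

Lemma enorm_eq0 x : (enorm x == 0) = (x == 0).
Proof. by rewrite -sqrf_eq0 enorm_sqr dotp_eq0. Qed.

Lemma enorm0 : enorm (0 : 'cV[R]_n) = 0.
Proof. by apply/eqP; rewrite enorm_eq0. Qed.

Lemma enormZ a x : enorm (a *: x) = `|a| * enorm x.
Proof.
by rewrite /enorm dotpZl dotpZr mulrA -expr2 sqrtrM ?sqr_ge0 // sqrtr_sqr.
Qed.

Lemma enormN x : enorm (- x) = enorm x.
Proof. by rewrite /enorm dotpNl dotpNr opprK. Qed.

Lemma enorm_le x y : (enorm x <= enorm y) = (dotp x x <= dotp y y).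
Proof. by rewrite /enorm ler_sqrt // dotp_ge0. Qed.

Lemma enorm_coord_le x i : `|x i ord0| <= enorm x.
Proof. by rewrite -sqrtr_sqr ler_sqrt ?dotp_ge0 // dotp_coord_le. Qed.

Lemma mx_norm_le_enorm x : `|x| <= enorm x.
Proof.
rewrite [leLHS]/Num.norm /= mx_normrE; apply: bigmax_le; first exact: enorm_ge0.
by move=> [i j] _ /=; rewrite ord1 enorm_coord_le.
Qed.

(** With a = <x, M x>, b = <x, M y>, c = <y, M y>, the form at c x - b y is c (a c - b^2) >= 0, and
    c > 0 cancels. *)
Lemma posdef_cauchy_schwarz M x y : sym_mx M -> posdef_mx M ->
  dotp x (M *m y) ^+ 2 <= dotp x (M *m x) * dotp y (M *m y).
Proof.
move=> Msym Mpos.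
have [->|y0] := eqVneq y 0; first by rewrite mulmx0 !dotp0r mulr0 expr2 mul0r.
have c0 := Mpos _ y0.
have eb : dotp y (M *m x) = dotp x (M *m y) by rewrite dotpC dotp_mulmxl Msym.
have : 0 <= dotp (dotp y (M *m y) *: x - dotp x (M *m y) *: y)
    (M *m (dotp y (M *m y) *: x - dotp x (M *m y) *: y)).
  have [->|z0] := eqVneq (dotp y (M *m y) *: x - dotp x (M *m y) *: y) 0.
    by rewrite mulmx0 dotp0r.
  exact: ltW (Mpos _ z0).
rewrite mulmxDr mulmxN -!scalemxAr !dotp_lin eb.
move: (dotp x (M *m x)) (dotp x (M *m y)) (dotp y (M *m y)) c0 => a b c c0 h.
have {h} : 0 <= c * (a * c - b ^+ 2) by move: h; congr (_ <= _); ring.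
by rewrite pmulr_rge0 // subr_ge0.
Qed.

Lemma sym_mx1 : sym_mx (1%:M : 'M[R]_n).
Proof. exact: trmx1. Qed.

Lemma posdef_mx1 : posdef_mx (1%:M : 'M[R]_n).
Proof. by move=> x x0; rewrite mul1mx dotp_gt0. Qed.

Lemma dotp_sqr_le x y : dotp x y ^+ 2 <= dotp x x * dotp y y.
Proof. by have := posdef_cauchy_schwarz x y sym_mx1 posdef_mx1; rewrite !mul1mx. Qed.

Lemma dotp_le_enorm x y : dotp x y <= enorm x * enorm y.
Proof.
rewrite (le_trans (ler_norm _)) // -ler_sqr ?nnegrE ?normr_ge0 //.
  by rewrite real_normK ?num_real // exprMn !enorm_sqr dotp_sqr_le.
by rewrite mulr_ge0 ?enorm_ge0.
Qed.

Lemma enormD x y : enorm (x + y) <= enorm x + enorm y.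
Proof.
rewrite -ler_sqr ?nnegrE ?addr_ge0 ?enorm_ge0 // enorm_sqr !dotp_lin.
by rewrite (dotpC y x) sqrrD !enorm_sqr; have := dotp_le_enorm x y; lra.
Qed.

(** Cauchy-Schwarz on each row gives the Frobenius norm as a bound. It makes the set under the
    supremum of [opnorm] bounded, without which that supremum says nothing. *)
Lemma enorm_mulmx_bounded M : exists C, forall x, enorm (M *m x) <= C * enorm x.
Proof.
pose C := \sum_i dotp (row i M)^T (row i M)^T.
have C0 : 0 <= C by apply: sumr_ge0 => i _; exact: dotp_ge0.
exists (Num.sqrt C) => x; rewrite /enorm -sqrtrM // ler_sqrt ?mulr_ge0 ?dotp_ge0 //.
rewrite dotpE /C mulr_suml; apply: ler_sum => i _.
have -> : (M *m x) i ord0 = dotp (row i M)^T x.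
  by rewrite /dotp trmxK -row_mul [RHS]mxE.
by rewrite -expr2 dotp_sqr_le.
Qed.

Lemma enorm_mulmx_le M x : enorm (M *m x) <= opnorm M * enorm x.
Proof.
have [->|x0] := eqVneq x 0; first by rewrite mulmx0 enorm0 mulr0.
have nx : 0 < enorm x by rewrite lt_def enorm_eq0 x0 enorm_ge0.
rewrite -ler_pdivrMr // mulrC.
rewrite -[X in X * _](ger0_norm (ltW _)) ?invr_gt0 //.
rewrite -enormZ scalemxAr; apply: ub_le_sup.
  have [C leC] := enorm_mulmx_bounded M; exists C => _ [y /= y1 <-].
  by rewrite (le_trans (leC y)) // y1 mulr1.
exists ((enorm x)^-1 *: x) => //=.
by rewrite enormZ ger0_norm ?invr_ge0 ?enorm_ge0 // mulVf // gt_eqF.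
Qed.

Lemma posdef_unit M : (forall x, x != 0 -> 0 < dotp x (M *m x)) -> M \in unitmx.
Proof.
move=> Mpos; rewrite -unitmx_tr -row_free_unit -kermx_eq0.
apply/rowV0P => u /sub_kermxP uM.
have Mu : M *m u^T = 0 by apply: trmx_inj; rewrite trmx_mul trmxK uM trmx0.
apply/eqP; rewrite -[u]trmxK trmx_eq0; apply/negP => /negP /Mpos.
by rewrite Mu dotp0r ltxx.
Qed.

(** Bounds the least eigenvalue of M below by 1 / |M^-1| without spectral theory: Cauchy-Schwarz for
    the form of M at x and M^-1 x gives |x|^4 <= <x, M x> <M^-1 x, x>, and the last factor is at
    most |M^-1| |x|^2. *)
Lemma posdef_dotp_ge M x : sym_mx M -> posdef_mx M ->
  dotp x x <= opnorm (invmx M) * dotp x (M *m x).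
Proof.
move=> Msym Mpos; have Mu := posdef_unit Mpos.
have [->|x0] := eqVneq x 0; first by rewrite mulmx0 !dotp0r mulr0.
have := posdef_cauchy_schwarz x (invmx M *m x) Msym Mpos.
rewrite mulmxA mulmxV // mul1mx => cs.
have le2 : dotp (invmx M *m x) x <= opnorm (invmx M) * dotp x x.
  rewrite (le_trans (dotp_le_enorm _ _)) // -[dotp x x]enorm_sqr expr2 mulrA.
  by rewrite ler_wpM2r ?enorm_ge0 // enorm_mulmx_le.
have d0 := dotp_gt0 x0; have q0 := Mpos _ x0.
rewrite -(ler_pM2r d0) -expr2 (le_trans cs) //.
by rewrite -mulrA mulrCA ler_wpM2l // ltW.
Qed.

Lemma posdef_invmx M : sym_mx M -> posdef_mx M -> posdef_mx (invmx M).
Proof.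
move=> Msym Mpos x x0; have Mu := posdef_unit Mpos.
rewrite -{1}[x]mul1mx -(mulmxV Mu) -mulmxA dotp_mulmxl Msym; apply: Mpos.
by apply: contraNneq x0 => e; rewrite -[x]mul1mx -(mulmxV Mu) -mulmxA e mulmx0.
Qed.

Lemma sym_invmx M : sym_mx M -> sym_mx (invmx M).
Proof. by rewrite /sym_mx trmx_inv => ->. Qed.

End Euclidean.

(** * Limits of matrices and vectors along a filter *)

Section MatrixLimits.
Context {R : realType} {I : Type} (F : set_system I) {FF : Filter F}.

Lemma cvg_mx (m n : nat) (f : I -> 'M[R]_(m, n)) (M : 'M[R]_(m, n)) :
  (forall i j, (fun t => f t i j) @ F --> M i j) -> f @ F --> M.
Proof.
move=> fM A [P MP PA]; rewrite /= nbhs_filterE.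
have : F [set t | forall ij : 'I_m * 'I_n, P ij.1 ij.2 (f t ij.1 ij.2)].
  by apply: filter_forall => -[i j] /=; exact: (fM i j _ (MP i j)).
move=> FP; apply: (@filterS _ F _ _ _ _ FP) => t Pt.
by apply: (PA (f t)) => i j; exact: (Pt (i, j)).
Qed.

Lemma cvg_entry (m n : nat) (f : I -> 'M[R]_(m, n)) (M : 'M[R]_(m, n)) i j :
  f @ F --> M -> (fun t => f t i j) @ F --> M i j.
Proof.
move=> fM; exact: (cvg_comp _ (fun N : 'M[R]_(m, n) => N i j : R) fM
  (@coord_continuous R m n i j M)).
Qed.

Lemma cvg_trmx (n : nat) (f : I -> 'rV[R]_n) (v : 'rV[R]_n) :
  f @ F --> v -> (fun t => (f t)^T) @ F --> v^T.
Proof.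
move=> fv; apply: cvg_mx => i j; rewrite mxE.
have e (w : 'rV[R]_n) : w^T i j = w j i by rewrite mxE.
under eq_fun do rewrite e.
by apply: cvg_entry fv.
Qed.

Lemma cvg_mulmx (m n p : nat) (f : I -> 'M[R]_(m, n)) (g : I -> 'M[R]_(n, p))
    (A : 'M[R]_(m, n)) (B : 'M[R]_(n, p)) :
  f @ F --> A -> g @ F --> B -> (fun t => f t *m g t) @ F --> A *m B.
Proof.
move=> fA gB; apply: cvg_mx => i k.
under eq_fun do rewrite mxE; rewrite mxE.
apply: cvg_big => [|j _]; first exact: add_continuous.
by apply: cvgM; exact: cvg_entry.
Qed.

Lemma cvg_dotp (n : nat) (f g : I -> 'cV[R]_n) (a b : 'cV[R]_n) :
  f @ F --> a -> g @ F --> b -> (fun t => dotp (f t) (g t)) @ F --> dotp a b.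
Proof.
move=> fa gb; under eq_fun do rewrite dotpE; rewrite dotpE.
apply: cvg_big => [|j _]; first exact: add_continuous.
by apply: cvgM; exact: cvg_entry.
Qed.

Lemma cvg_enorm (n : nat) (f : I -> 'cV[R]_n) (a : 'cV[R]_n) :
  f @ F --> a -> (fun t => enorm (f t)) @ F --> enorm a.
Proof.
move=> fa; exact: (cvg_comp (fun t => dotp (f t) (f t)) Num.sqrt
  (cvg_dotp fa fa) (@sqrt_continuous R _)).
Qed.

(** The topology is that of the max norm, which the Euclidean norm dominates. *)
Lemma cvg_enorm0 (n : nat) (f : I -> 'cV[R]_n) (a : 'cV[R]_n) :
  (fun t => enorm (f t - a)) @ F --> 0 -> f @ F --> a.
Proof.
move=> fa; apply/cvgrPdist_lt => e e0.
move/cvgrPdist_lt : fa => /(_ _ e0); apply: filterS => t.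
rewrite sub0r normrN ger0_norm ?enorm_ge0 //.
by rewrite distrC; apply: le_lt_trans; exact: mx_norm_le_enorm.
Qed.

End MatrixLimits.

(** * Locality of the differential and Jacobians of column maps *)

Section Differentials.
Variable R : realType.

Lemma trmx_continuous (n : nat) : continuous (fun v : 'rV[R]_n => v^T).
Proof.
by move=> v; have vv : (fun w => w) @ v --> v by []; exact: (cvg_trmx vv).
Qed.

(** The first-order expansion of [g] at [x] is also one of [f], and a differential is unique. This
    allows [P] to be replaced by a local formula. *)
Lemma near_eq_differentiable (V W : normedModType R) (f g : V -> W) (x : V) :
  (\near x, f x = g x) -> differentiable g x ->
  differentiable f x /\ 'd f x = 'd g x :> (V -> W).
Proof.
move=> fg dg; have gc : continuous ('d g x) by exact: diff_continuous.
have fE : f \o shift x = cst (f x) + 'd g x +o_ 0 id.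
  apply/eqaddoP => e e0.
  have /eqaddoP /(_ e e0) := diff_locally dg.
  have : \forall h \near 0, f (h + x) = g (h + x).
    by move: fg; rewrite (near_shift 0) subr0.
  apply: filterS2 => h /= fgh; rewrite !fctE /= fgh.
  by rewrite (nbhs_singleton fg).
have df := diff_unique gc fE.
split => //; apply/diff_locallyP; rewrite df; split => //.
Qed.

Lemma differentiable_entries (V : normedModType R) (n : nat)
    (f : V -> 'cV[R]_n) (x : V) :
  (forall i, differentiable (fun y => f y i ord0 : R) x) -> differentiable f x.
Proof.
move=> fi.
have -> : f = \sum_(i < n) (fun y => f y i ord0 *: (delta_mx i ord0 : 'cV[R]_n)).
  apply/funext => y; rewrite fct_sumE {1}[f y]matrix_sum_delta.
  by apply: eq_bigr => i _; rewrite big_ord1.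
by apply: differentiable_sum => i; exact: differentiableZl.
Qed.

Lemma jacobian_mxE (m n : nat) (f : 'cV[R]_n -> 'cV[R]_m) x v :
  jacobian_mx f x *m v = 'd f x v.
Proof.
rewrite {2}[v]matrix_sum_delta; under eq_bigr do rewrite big_ord1.
rewrite linear_sum; apply/matrixP => i j; rewrite ord1 mxE summxE.
by apply: eq_bigr => k _; rewrite linearZ !mxE mulrC.
Qed.

Lemma mx_eq_mulcol (m n : nat) (A B : 'M[R]_(m, n)) :
  (forall v : 'cV[R]_n, A *m v = B *m v) -> A = B.
Proof.
move=> AB; apply/matrixP => i j.
by have /colP/(_ i) := AB (delta_mx j ord0); rewrite -!colE !mxE.
Qed.

(** Through this limit, relations between difference quotients pass to the Jacobian. *)
Lemma cvg_jacobian_mx (m n : nat) (f : 'cV[R]_n -> 'cV[R]_m) x v :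
  differentiable f x ->
  (fun t : R => t^-1 *: (f (t *: v + x) - f x)) @ 0^' --> jacobian_mx f x *m v.
Proof.
move=> df; rewrite jacobian_mxE -deriveE //.
exact: (diff_derivable df).
Qed.

End Differentials.

(** * The second order cone and Moreau decompositions *)

Section SecondOrderCone.
Variables (R : realType) (m : nat).
Implicit Types (x y z p q : 'cV[R]_m.+1) (a : R).

Definition hd x : R := x ord0 ord0.
Definition tl x : 'cV[R]_m := dsubmx (x : 'cV[R]_(1 + m)).
Definition axis : 'cV[R]_m.+1 := delta_mx ord0 ord0.

Lemma hdD x y : hd (x + y) = hd x + hd y. Proof. exact: mxE. Qed.
Lemma hdZ a x : hd (a *: x) = a * hd x. Proof. exact: mxE. Qed.
Lemma hdN x : hd (- x) = - hd x. Proof. exact: mxE. Qed.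
Lemma hd_axis : hd axis = 1. Proof. by rewrite /hd mxE. Qed.
Lemma tlD x y : tl (x + y) = tl x + tl y.
Proof. by apply/matrixP => i j; rewrite !mxE. Qed.
Lemma tlZ a x : tl (a *: x) = a *: tl x.
Proof. by apply/matrixP => i j; rewrite !mxE. Qed.
Lemma tlN x : tl (- x) = - tl x.
Proof. by apply/matrixP => i j; rewrite !mxE. Qed.
Lemma tl_axis : tl axis = 0.
Proof. by apply/matrixP => i j; rewrite !mxE. Qed.

Lemma dotp_hd_tl x y : dotp x y = hd x * hd y + dotp (tl x) (tl y).
Proof.
rewrite dotpE big_ord_recl dotpE; congr (_ + _).
apply: eq_bigr => i _; rewrite !mxE.
by congr (x _ _ * y _ _); apply: val_inj.
Qed.

Lemma socE x : soc x = (enorm (tl x) <= hd x) :> Prop.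
Proof. by []. Qed.

Lemma soc0 : soc (0 : 'cV[R]_m.+1).
Proof.
rewrite socE; have -> : tl 0 = 0 by apply/matrixP => i j; rewrite !mxE.
by rewrite enorm0 /hd mxE.
Qed.

Lemma socD x y : soc x -> soc y -> soc (x + y).
Proof.
rewrite !socE => sx sy; rewrite tlD hdD.
by rewrite (le_trans (enormD _ _)) // lerD.
Qed.

Lemma socZ a x : 0 <= a -> soc x -> soc (a *: x).
Proof. by rewrite !socE => a0 sx; rewrite tlZ hdZ enormZ ger0_norm // ler_wpM2l. Qed.

(** Half of self-duality: - <x_2, y_2> <= |x_2| |y_2| <= x_1 y_1. *)
Lemma soc_dotp_ge0 x y : soc x -> soc y -> 0 <= dotp x y.
Proof.
rewrite !socE => sx sy; rewrite dotp_hd_tl.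
have := dotp_le_enorm (- tl x) (tl y); rewrite dotpNl enormN => le1.
have := ler_pM (enorm_ge0 _) (enorm_ge0 _) sx sy; lra.
Qed.

(** Moreau's conditions: [p] lies in the cone, [x - p] in its polar, and the two are orthogonal.
    They replace minimality of the distance by relations that can be checked on a formula. *)
Definition moreau x p :=
  [/\ soc p, dotp (x - p) p = 0 & forall y, soc y -> dotp (x - p) y <= 0].

(** The cross term 2 <x - p, p - y> equals - 2 <x - p, y>, which is nonnegative. The surplus |p -
    y|^2 gives uniqueness of the projection along with minimality. *)
Lemma moreau_dist x p y : moreau x p -> soc y ->
  dotp (x - p) (x - p) + dotp (p - y) (p - y) <= dotp (x - y) (x - y).
Proof.
move=> [_ xp_p xp_le] /xp_le xpy.
have -> : x - y = (x - p) + (p - y) by rewrite addrA subrK.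
move: (x - p) xp_p xpy => u up uy.
by rewrite !dotp_lin (dotpC p u) (dotpC y u) up; lra.
Qed.

Lemma moreau_mproj x p : moreau x p -> mproj (@soc R m) x = p.
Proof.
move=> xp; have [sp _ _] := xp.
have pr : is_proj (@soc R m) x p.
  split=> // y /(moreau_dist xp) le1; rewrite enorm_le.
  by apply: le_trans le1; rewrite lerDl dotp_ge0.
(* [mproj] is a chosen minimizer, known only through [is_proj]; comparing it with [p] leaves no room
   for a positive surplus. *)
have [sq /(_ _ sp)] : is_proj (@soc R m) x (mproj (@soc R m) x).
  by apply: getPex; exists p.
rewrite enorm_le => le1; have le2 := moreau_dist xp sq.
apply/esym/eqP; rewrite -subr_eq0 -dotp_eq0 eq_le dotp_ge0 andbT.
by lra.
Qed.

(** The factor that the projection applies to the tail x_2 when x is outside the cone and its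
    polar. *)
Definition soc_scale x := (hd x + enorm (tl x)) / (2 * enorm (tl x)).

(* Equals [(x_1 + |x_2|) / 2 *: (1, x_2 / |x_2|)]. *)
Definition soc_side x := soc_scale x *: (x + (enorm (tl x) - hd x) *: axis).

Lemma moreau_inside x : soc x -> moreau x x.
Proof. by move=> sx; split=> // [|y _]; rewrite subrr dotp0l. Qed.

Lemma moreau_polar x : soc (- x) -> moreau x 0.
Proof.
move=> sx; split; rewrite ?subr0 ?dotp0r //; first exact: soc0.
by move=> y /(soc_dotp_ge0 sx); rewrite dotpNl oppr_ge0.
Qed.

(** The residual is (|x_2| - x_1) / 2 times (-1, x_2 / |x_2|), on a boundary ray of the polar cone
    orthogonal to the ray of (1, x_2 / |x_2|). *)
Lemma moreau_side x : `|hd x| < enorm (tl x) -> moreau x (soc_side x).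
Proof.
rewrite ltr_norml => /andP[lo hi].
have s0 : 0 < enorm (tl x) by lra.
have a0 : 0 < soc_scale x by rewrite divr_gt0 //; lra.
have hs : hd (soc_side x) = soc_scale x * enorm (tl x).
  by rewrite /soc_side hdZ hdD hdZ hd_axis mulr1 addrC subrK.
have ts : tl (soc_side x) = soc_scale x *: tl x.
  by rewrite /soc_side tlZ tlD tlZ tl_axis scaler0 addr0.
have scaleE : soc_scale x * enorm (tl x) = (hd x + enorm (tl x)) / 2.
  by rewrite /soc_scale; field; rewrite gt_eqF.
have hu : hd (x - soc_side x) = (hd x - enorm (tl x)) / 2.
  by rewrite hdD hdN hs scaleE; field.
have tu : tl (x - soc_side x) = (1 - soc_scale x) *: tl x.
  by rewrite tlD tlN ts scalerBl scale1r.
have cE : (1 - soc_scale x) * enorm (tl x) = (enorm (tl x) - hd x) / 2.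
  by rewrite mulrBl mul1r scaleE; field.
have c0 : 0 <= 1 - soc_scale x.
  by rewrite -(pmulr_lge0 _ s0) cE; lra.
split.
- by rewrite socE hs ts enormZ gtr0_norm.
- rewrite dotp_hd_tl hs ts hu tu dotpZl dotpZr -enorm_sqr.
  have -> : (1 - soc_scale x) * (soc_scale x * enorm (tl x) ^+ 2) =
     ((1 - soc_scale x) * enorm (tl x)) * (soc_scale x * enorm (tl x)) by ring.
  by rewrite cE; ring.
- move=> y; rewrite socE => sy; rewrite dotp_hd_tl hu tu dotpZl.
  have le1 := ler_wpM2l c0 (dotp_le_enorm (tl x) (tl y)).
  rewrite mulrA cE in le1.
  have : (enorm (tl x) - hd x) / 2 * enorm (tl y) <= (enorm (tl x) - hd x) / 2 * hd y.
    by apply: ler_wpM2l sy; lra.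
  by lra.
Qed.

End SecondOrderCone.

(** * Firm nonexpansiveness and homogeneity, from the projection to its B-subdifferential *)

Section ConeProjection.
Variables (R : realType) (m : nat).
Implicit Types (x y z p q u v : 'cV[R]_m.+1) (a : R) (V : 'M[R]_m.+1).
Local Notation P := (mproj (@soc R m)).

Lemma mproj_inside x : soc x -> P x = x.
Proof. by move=> /moreau_inside /moreau_mproj. Qed.

Lemma mproj_polar x : soc (- x) -> P x = 0.
Proof. by move=> /moreau_polar /moreau_mproj. Qed.

Lemma mproj_side x : `|hd x| < enorm (tl x) -> P x = soc_side x.
Proof. by move=> /moreau_side /moreau_mproj. Qed.

Lemma soc_cases x : [\/ soc x, soc (- x) | `|hd x| < enorm (tl x)].
Proof.
rewrite !socE tlN hdN enormN.
have [|h1] := leP (enorm (tl x)) (hd x); first by constructor 1.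
have [|h2] := leP (enorm (tl x)) (- hd x); first by constructor 2.
by constructor 3; rewrite ltr_norml; apply/andP; split; lra.
Qed.

Lemma mproj_moreau x : moreau x (P x).
Proof.
case: (soc_cases x) => xs.
- by rewrite mproj_inside //; exact: moreau_inside.
- by rewrite mproj_polar //; exact: moreau_polar.
- by rewrite mproj_side //; exact: moreau_side.
Qed.

(** The difference of the two sides is <P x - P y, (x - P x) - (y - P y)>. Orthogonality reduces it
    to - <x - P x, P y> - <y - P y, P x>, and both terms are nonnegative by polarity. *)
Lemma mproj_firm x y : dotp (P x - P y) (P x - P y) <= dotp (P x - P y) (x - y).
Proof.
have [sp up ule] := mproj_moreau x; have [sq vq vle] := mproj_moreau y.
have uq := ule _ sq; have vp := vle _ sp.
have -> : x - y = (P x - P y) + ((x - P x) - (y - P y)).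
  by apply/matrixP => i j; rewrite !mxE; ring.
rewrite [leRHS]dotpDr lerDl dotpC.
move: (x - P x) (y - P y) up vq uq vp => u v up vq uq vp.
by rewrite !dotp_lin up vq; lra.
Qed.

Lemma mproj_nonexpansive x y : enorm (P x - P y) <= enorm (x - y).
Proof.
have le1 := mproj_firm x y; have le2 := dotp_le_enorm (P x - P y) (x - y).
have [->|n0] := eqVneq (enorm (P x - P y)) 0; first exact: enorm_ge0.
rewrite -(@ler_pM2l _ (enorm (P x - P y))) ?lt_def ?n0 ?enorm_ge0 //.
by rewrite -expr2 enorm_sqr (le_trans le1).
Qed.

Lemma cvg_mproj (I : Type) (F : set_system I) {FF : Filter F}
    (f : I -> 'cV[R]_m.+1) x :
  f @ F --> x -> (fun t => P (f t)) @ F --> P x.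
Proof.
move=> fx; apply: cvg_enorm0.
have fx0 : (fun t => enorm (f t - x)) @ F --> 0.
  rewrite -(@enorm0 R m.+1) -(subrr x); apply: cvg_enorm.
  by apply: cvgB => //; exact: cvg_cst.
apply: squeeze_cvgr (cvg_cst 0) fx0; apply: nearW => t.
by rewrite enorm_ge0 mproj_nonexpansive.
Qed.

Lemma mprojZ a x : 0 <= a -> P (a *: x) = a *: P x.
Proof.
move=> a0; have [sp up ule] := mproj_moreau x.
apply: moreau_mproj; split; first exact: socZ.
  by rewrite -scalerBr dotpZl dotpZr up !mulr0.
by move=> y /ule le0; rewrite -scalerBr dotpZl mulr_ge0_le0.
Qed.

(** Firm nonexpansiveness between [t *: v + u] and [u], divided by t^2 (t may be negative), in the
    limit t -> 0. *)
Lemma jacobian_mproj_firm u v : differentiable P u ->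
  dotp (jacobian_mx P u *m v) (jacobian_mx P u *m v) <=
  dotp (jacobian_mx P u *m v) v.
Proof.
move=> dP; have cq := cvg_jacobian_mx (v := v) dP.
apply: (ler_cvg_to (cvg_dotp cq cq) (cvg_dotp cq (cvg_cst v))).
near=> t; have t0 : t != 0 by near: t; exact: nbhs_dnbhs_neq.
have := mproj_firm (t *: v + u) u; rewrite addrK dotpZr => le1.
rewrite !dotpZl !dotpZr mulrA -expr2.
have -> : t^-1 * dotp (P (t *: v + u) - P u) v =
  t^-1 ^+ 2 * (t * dotp (P (t *: v + u) - P u) v) by field.
by apply: ler_wpM2l le1; exact: sqr_ge0.
Unshelve. all: by end_near. Qed.

(** Euler's identity for degree one: the difference quotient along [u] is constantly [P u] as soon
    as t + 1 >= 0. *)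
Lemma jacobian_mproj_self u : differentiable P u -> jacobian_mx P u *m u = P u.
Proof.
move=> dP; have cq := cvg_jacobian_mx (v := u) dP.
apply: (cvg_unique _ cq) => //.
apply: cvg_near_cst; near=> t.
have t0 : t != 0 by near: t; exact: nbhs_dnbhs_neq.
have t1 : 0 <= t + 1.
  have : `|t| < 1 by near: t; apply: dnbhs0_lt.
  by rewrite ltr_norml => /andP[]; lra.
have -> : t *: u + u = (t + 1) *: u by rewrite scalerDl scale1r.
rewrite mprojZ // scalerDl scale1r addrK.
by rewrite scalerA mulVf // scale1r.
Unshelve. all: by end_near. Qed.

Lemma bsubdiff_mproj_firm x V v : bsubdiff P x V ->
  dotp (V *m v) (V *m v) <= dotp (V *m v) v.
Proof.
move=> [u [du ux JV]].
have JVv : (fun k => jacobian_mx P (u k) *m v) @ \oo --> V *m v.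
  by apply: cvg_mulmx JV _; exact: cvg_cst.
apply: (ler_cvg_to (cvg_dotp JVv JVv) (cvg_dotp JVv (cvg_cst v))).
by apply: nearW => k; exact: jacobian_mproj_firm.
Qed.

(** This identity makes (V + T) y = b a true Newton step, (V + T) (y - x) = b - P x - T x. *)
Lemma bsubdiff_mproj_self x V : bsubdiff P x V -> V *m x = P x.
Proof.
move=> [u [du ux JV]].
apply: (cvg_unique _ (cvg_mulmx JV ux)) => //.
have -> : (fun k => jacobian_mx P (u k) *m u k) = P \o u.
  by apply/funext => k; exact: jacobian_mproj_self.
exact: cvg_mproj.
Qed.

End ConeProjection.

(** * Differentiability of the projection and nonemptiness of its B-subdifferential *)

Section BSubdifferential.
Variables (R : realType) (m : nat).
Implicit Types (x y u : 'cV[R]_m.+1).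
Local Notation P := (mproj (@soc R m)).

Lemma cvg_tl (I : Type) (F : set_system I) {FF : Filter F}
    (f : I -> 'cV[R]_m.+1) x :
  f @ F --> x -> (fun t => tl (f t)) @ F --> tl x.
Proof.
move=> fx; apply: cvg_mx => i j; rewrite ord1.
have e y : tl y i ord0 = y (rshift 1 i) ord0 by rewrite mxE.
rewrite e; under eq_fun do rewrite e.
by apply: cvg_entry fx.
Qed.

(** Serves twice: a positive gap x_1 - |x_2| persists nearby, and the cone, where the gap is
    nonnegative, is closed. *)
Lemma cvg_soc_gap (I : Type) (F : set_system I) {FF : Filter F}
    (f : I -> 'cV[R]_m.+1) x : f @ F --> x ->
  (fun t => hd (f t) - enorm (tl (f t))) @ F --> hd x - enorm (tl x).
Proof.
move=> fx; apply: cvgB; first by rewrite /hd; apply: cvg_entry fx.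
exact: cvg_enorm (cvg_tl fx).
Qed.

Lemma near_inside u : enorm (tl u) < hd u -> \forall y \near u, soc y.
Proof.
move=> lt_u; have uu : (fun y => y) @ u --> u by [].
have cg : (fun y => hd y - enorm (tl y)) @ u --> hd u - enorm (tl u).
  exact: (cvg_soc_gap uu).
have : \forall y \near u, 0 < hd y - enorm (tl y).
  by apply: (cvgr_gt _ cg); rewrite subr_gt0.
by apply: filterS => y; rewrite subr_gt0 socE => /ltW.
Qed.

Lemma jacobian_inside u : enorm (tl u) < hd u ->
  differentiable P u /\ jacobian_mx P u = 1%:M.
Proof.
move=> lt_u.
have Pid : \near u, P u = id u.
  by move: (near_inside lt_u); apply: filterS => y; exact: mproj_inside.
have [dP dPE] := near_eq_differentiable Pid (@ex_diff _ _ _ _ _ _ _ (is_diff_id u)).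
split; first exact: dP.
apply: mx_eq_mulcol => v; rewrite jacobian_mxE mul1mx.
have di : 'd id u = id :> ('cV[R]_m.+1 -> 'cV[R]_m.+1) by exact: diff_val.
exact: (etrans (congr1 (@^~ v) dPE) (congr1 (@^~ v) di)).
Qed.

Lemma jacobian_polar u : enorm (tl u) < - hd u ->
  differentiable P u /\ jacobian_mx P u = 0.
Proof.
move=> lt_u.
have P0 : \near u, P u = cst 0 u.
  have : \forall y \near - u, soc y by apply: near_inside; rewrite tlN enormN hdN.
  (* The neighbourhood of [- u] is pulled back to one of [u] by negation. *)
  move=> /(@oppr_continuous R _ u) nu.
  by apply: (@filterS _ (nbhs u) _ _ _ _ nu) => y; exact: mproj_polar.
have [dP dPE] := near_eq_differentiable P0 (differentiable_cst 0 u).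
split; first exact: dP.
apply: mx_eq_mulcol => v; rewrite jacobian_mxE mul0mx.
exact: (etrans (congr1 (@^~ v) dPE) (congr1 (@^~ v) (diff_cst _ _))).
Qed.

Lemma differentiable_enorm_tl u : 0 < enorm (tl u) ->
  differentiable (fun y => enorm (tl y) : R) u.
Proof.
move=> u0.
pose c (i : 'I_m) y : R := y (lift ord0 i) ord0.
have sumE y : (\sum_(i < m) c i * c i) y = dotp (tl y) (tl y).
  rewrite dotpE fct_sumE; apply: eq_bigr => i _; rewrite mxE.
  by congr (y _ _ * y _ _); apply: val_inj.
have -> : (fun y => enorm (tl y)) = Num.sqrt \o (\sum_(i < m) c i * c i).
  by apply/funext => y /=; rewrite sumE.
apply: differentiable_comp.
  apply: differentiable_sum => i.
  by apply: differentiableM; exact: differentiable_coord.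
have s0 : 0 < (\sum_(i < m) c i * c i) u by rewrite sumE -enorm_sqr exprn_gt0.
by apply/derivable1_diffP; have [] := is_derive1_sqrt s0.
Qed.

Lemma differentiable_side u : `|hd u| < enorm (tl u) -> differentiable P u.
Proof.
move=> lt_u; have u0 : 0 < enorm (tl u) by rewrite (le_lt_trans _ lt_u).
have ds := differentiable_enorm_tl u0.
have dh : differentiable (fun y => hd y : R) u by exact: differentiable_coord.
have nearP : \near u, P u = soc_side u.
  have : \forall y \near u, 0 < enorm (tl y) - `|hd y|.
    have cd : (fun y => enorm (tl y) - `|hd y|) @ u --> enorm (tl u) - `|hd u|.
      exact: (cvgB (differentiable_continuous ds)
        (cvg_norm (differentiable_continuous dh))).
    by apply: (cvgr_gt _ cd); rewrite subr_gt0.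
  by apply: filterS => y; rewrite subr_gt0; exact: mproj_side.
apply: (proj1 (near_eq_differentiable nearP _)).
apply: differentiable_entries => i.
(* Each entry is rewritten with operations on functions, so that the sum, product and inverse rules
   apply; the denominator is nonzero because |u_2| > 0. *)
have -> : (fun y => soc_side y i ord0) =
    ((fun y => hd y) + (fun y => enorm (tl y))) *
    (fun y => (2 * enorm (tl y))^-1) *
    ((fun y => y i ord0) +
     ((fun y => enorm (tl y)) - (fun y => hd y)) * cst (axis R m i ord0)).
  by apply/funext => y; rewrite !mxE.
apply: differentiableM.
  apply: differentiableM; first exact: differentiableD.
  apply: differentiableV; last by rewrite mulf_neq0 // gt_eqF.
  by apply: differentiableM => //; exact: differentiable_cst.
apply: differentiableD; first exact: differentiable_coord.
by apply: differentiableM; [exact: differentiableB|exact: differentiable_cst].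
Unshelve. all: by end_near. Qed.

Lemma cvg_axis u (s : R) : (fun k => u + (s * k.+1%:R^-1) *: axis R m) @ \oo --> u.
Proof.
rewrite -[X in _ --> X](addr0 u) -(scale0r (axis R m)).
apply: cvgD; first exact: cvg_cst.
apply: cvgZr_tmp; rewrite -(mulr0 s); apply: cvgM; first exact: cvg_cst.
exact: cvg_harmonic.
Qed.

(** Without this the Newton iteration could stop for want of a matrix, and nonsingularity for every
    choice could hold vacuously. *)
Lemma bsubdiff_mproj_nonempty (x : 'cV[R]_m.+1) : bsubdiff P x !=set0.
Proof.
have h0 (k : nat) : 0 < k.+1%:R^-1 :> R by rewrite invr_gt0 ltr0Sn.
have [xs|xs|xs] := soc_cases x.
(* Raising x_1 by 1 / (k + 1) leads from the cone, boundary and apex included, into its interior. *)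
- have din k : differentiable P (x + (1 * k.+1%:R^-1) *: axis R m) /\
      jacobian_mx P (x + (1 * k.+1%:R^-1) *: axis R m) = 1%:M.
    apply: jacobian_inside; rewrite mul1r tlD tlZ tl_axis scaler0 addr0.
    rewrite hdD hdZ hd_axis mulr1; move: xs; rewrite socE => xs.
    by rewrite (le_lt_trans xs) // ltrDl.
  exists 1%:M, (fun k => x + (1 * k.+1%:R^-1) *: axis R m); split.
  + by move=> k; exact: (proj1 (din k)).
  + exact: cvg_axis.
  + have -> : (fun k => jacobian_mx P (x + (1 * k.+1%:R^-1) *: axis R m)) =
        (fun=> 1%:M) by apply/funext => k; exact: (proj2 (din k)).
    exact: cvg_cst.
- have din k : differentiable P (x + (- 1 * k.+1%:R^-1) *: axis R m) /\
      jacobian_mx P (x + (- 1 * k.+1%:R^-1) *: axis R m) = 0.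
    apply: jacobian_polar; rewrite tlD tlZ tl_axis scaler0 addr0.
    rewrite hdD hdZ hd_axis mulr1; move: xs; rewrite socE tlN hdN enormN => xs.
    by rewrite (le_lt_trans xs) // mulN1r opprD opprK ltrDl.
  exists 0, (fun k => x + (- 1 * k.+1%:R^-1) *: axis R m); split.
  + by move=> k; exact: (proj1 (din k)).
  + exact: cvg_axis.
  + have -> : (fun k => jacobian_mx P (x + (- 1 * k.+1%:R^-1) *: axis R m)) =
        (fun=> 0) by apply/funext => k; exact: (proj2 (din k)).
    exact: cvg_cst.
(* Here [P] is differentiable at [x] itself, so a constant sequence suffices. *)
- exists (jacobian_mx P x), (fun=> x); split.
  + by move=> _; exact: differentiable_side.
  + exact: cvg_cst.
  + exact: cvg_cst.
Qed.

End BSubdifferential.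

(** * Existence and uniqueness of the solution, and the Newton step *)

Section Solution.
Variables (R : realType) (m : nat) (T : 'M[R]_m.+1).
Hypotheses (T_sym : sym_mx T) (T_posdef : posdef_mx T).
Implicit Types (b c p x y z : 'cV[R]_m.+1).
Local Notation P := (mproj (@soc R m)).

(** For c = T^-1 b and x = T^-1 (b - p), the gradient A p - c of [q c] at p is p - x. *)
Let A := 1%:M + invmx T.
Let q c p := dotp p (A *m p) / 2 - dotp c p.

(** Gives coercivity of [q c], and its convexity along segments. *)
Lemma shifted_form_ge p : dotp p p <= dotp p (A *m p).
Proof.
rewrite mulmxDl mul1mx dotpDr lerDl.
have [->|p0] := eqVneq p 0; first by rewrite mulmx0 dotp0r.
exact: ltW (posdef_invmx T_sym T_posdef p0).
Qed.

Lemma cvg_quadratic (I : Type) (F : set_system I) {FF : Filter F}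
    (f : I -> 'cV[R]_m.+1) c p :
  f @ F --> p -> (fun t => q c (f t)) @ F --> q c p.
Proof.
move=> fp; apply: cvgB; last by apply: cvg_dotp fp; exact: cvg_cst.
apply: cvgM; last exact: cvg_cst.
by apply: (cvg_dotp fp); apply: cvg_mulmx fp; exact: cvg_cst.
Qed.

(* Rows rather than columns, because the library's compactness criterion is
   stated for row vectors. *)
Lemma compact_soc_ball (r : R) :
  compact [set v : 'rV[R]_m.+1 | soc v^T /\ enorm v^T <= r].
Proof.
apply: bounded_closed_compact.
  exists r; split; first exact: num_real.
  move=> M rM v /= [_ vr]; rewrite (le_trans _ (ltW rM)) // (le_trans _ vr) //.
  rewrite [leLHS]/Num.norm /= mx_normrE; apply: bigmax_le; first exact: enorm_ge0.
  move=> [i j] _ /=; rewrite ord1.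
  by have := enorm_coord_le v^T j; rewrite mxE.
have -> : [set v : 'rV[R]_m.+1 | soc v^T /\ enorm v^T <= r] =
    (fun v : 'rV[R]_m.+1 => hd v^T - enorm (tl v^T)) @^-1` [set s | 0 <= s] `&`
    (fun v : 'rV[R]_m.+1 => enorm v^T) @^-1` [set s | s <= r].
  by apply/seteqP; split => v /=; rewrite subr_ge0.
apply: closedI; apply: preimage_closed; [|exact: closed_ge| |exact: closed_le].
  by move=> v _; exact: (cvg_soc_gap (@trmx_continuous R _ v)).
by move=> v _; exact: (cvg_enorm (@trmx_continuous R _ v)).
Qed.

Lemma quadratic_minimizer c :
  exists2 p, soc p & forall y, soc y -> q c p <= q c y.
Proof.
(* Since q(y) >= |y|^2 / 2 - |c| |y|, q is nonnegative once |y| >= 2 |c|. As q(0) = 0 and the ball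
   contains 0, a minimizer on the ball is global. *)
pose r := 2 * enorm c.
have r0 : 0 <= r by rewrite mulr_ge0 ?enorm_ge0.
pose B := [set v : 'rV[R]_m.+1 | soc v^T /\ enorm v^T <= r].
have B0 : B 0 by split; rewrite trmx0 ?enorm0 //; exact: soc0.
have qc : {within B, continuous (fun v : 'rV[R]_m.+1 => q c v^T)}.
  apply: continuous_subspaceT => v.
  have tv : (fun w : 'rV[R]_m.+1 => w^T) @ v --> v^T by exact: trmx_continuous.
  have qv : (fun w : 'rV[R]_m.+1 => q c w^T) @ v --> q c v^T.
    exact: (cvg_quadratic (c := c) tv).
  exact: qv.
have [v /set_mem [sv vr] vmin] :=
  compact_EVT_min (ex_intro _ _ B0) (@compact_soc_ball r) qc.
exists v^T => // y sy.
have [yr|ry] := leP (enorm y) r.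
  have -> : y = y^T^T by rewrite trmxK.
  by apply: vmin; apply/mem_set; rewrite /B /= trmxK.
have v0 : q c v^T <= q c 0.
  by rewrite -(trmx0 R); apply: vmin; apply/mem_set.
apply: (le_trans v0); rewrite /q mulmx0 !dotp0r mul0r subr0.
have le1 := shifted_form_ge y; have le2 := dotp_le_enorm c y.
have : enorm y * r <= enorm y * enorm y by rewrite ler_wpM2l ?enorm_ge0 // ltW.
rewrite -expr2 enorm_sqr /r; lra.
Qed.

(** First-order optimality on the segment from p to y: the increment of q at time t is t (g + t h /
    2), negative for some t in (0, 1] if g < 0. *)
Lemma minimizer_variational c p y :
  soc p -> (forall z, soc z -> q c p <= q c z) -> soc y ->
  0 <= dotp (A *m p - c) (y - p).
Proof.
move=> sp pmin sy.
have As : A^T = A by rewrite /A linearD /= trmx1 (sym_invmx T_sym).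
pose g := dotp (A *m p - c) (y - p); pose h := dotp (y - p) (A *m (y - p)).
have h0 : 0 <= h by apply: le_trans (shifted_form_ge _); exact: dotp_ge0.
have ineq t : 0 <= t -> t <= 1 -> 0 <= t * (g + t * h / 2).
  move=> t0 t1.
  have st : soc (p + t *: (y - p)).
    have -> : p + t *: (y - p) = (1 - t) *: p + t *: y.
      by apply/matrixP => i j; rewrite !mxE; ring.
    by apply: socD; apply: socZ => //; lra.
  have := pmin _ st; rewrite -subr_ge0; congr (_ <= _).
  rewrite /g /h /q; move: (y - p) => d.
  rewrite mulmxDr -scalemxAr !dotp_lin (dotpC (A *m p) d).
  have -> : dotp p (A *m d) = dotp d (A *m p) by rewrite dotpC dotp_mulmxl As.
  by field.
rewrite leNgt -/g; apply/negP => g0.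
have hg : 0 < h - g by lra.
(* This t is at most 1 because h >= 0, stays defined when h = 0, and makes g + t h / 2 a positive
   multiple of g. *)
pose t := - g / (h - g).
have t0 : 0 < t by rewrite divr_gt0 // oppr_gt0.
have t1 : t <= 1 by rewrite ler_pdivrMr // mul1r; lra.
have := ineq t (ltW t0) t1; rewrite pmulr_rge0 // leNgt => /negP; apply.
have -> : g + t * h / 2 = g * ((h - 2 * g) / (2 * (h - g))).
  by rewrite /t; field; rewrite gt_eqF.
rewrite nmulr_rlt0 // divr_gt0 //; lra.
Qed.

Lemma mproj_equation_solvable b : exists x, P x + T *m x = b.
Proof.
have Tu : T \in unitmx by exact: posdef_unit.
have [p sp pmin] := quadratic_minimizer (invmx T *m b).
have vi y (sy : soc y) := minimizer_variational sp pmin sy.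
pose x := invmx T *m (b - p).
have xp : x - p = - (A *m p - invmx T *m b).
  by rewrite /x /A mulmxDl mul1mx mulmxBr; apply/matrixP => i j; rewrite !mxE; ring.
have xp_le y : soc y -> dotp (x - p) (y - p) <= 0.
  by move=> /vi; rewrite xp dotpNl oppr_le0.
(* Testing the variational inequality at 0 and at p + p gives both signs. *)
have xp0 : dotp (x - p) p = 0.
  have := xp_le _ (soc0 R m); have := xp_le _ (socD sp sp).
  by rewrite addrK sub0r dotpNr; lra.
have Px : P x = p.
  apply: moreau_mproj; split=> // y /xp_le.
  by rewrite dotpDr dotpNr xp0 subr0.
by exists x; rewrite Px /x mulmxA mulmxV // mul1mx addrC subrK.
Qed.

(** [P] is monotone, so <x - y, T (x - y)> = - <x - y, P x - P y> <= 0, against positivity of T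
    unless x = y. *)
Lemma mproj_equation_unique x y : P x + T *m x = P y + T *m y -> x = y.
Proof.
move=> xy; apply/eqP; rewrite -subr_eq0; apply/negPn/negP => /T_posdef.
have -> : T *m (x - y) = - (P x - P y).
  have -> : T *m (x - y) = (P x + T *m x) - (P y + T *m y) - (P x - P y).
    by rewrite mulmxBr; apply/matrixP => i j; rewrite !mxE; ring.
  by rewrite xy subrr sub0r.
have := le_trans (dotp_ge0 _) (mproj_firm x y).
by rewrite dotpNr dotpC; lra.
Qed.

Lemma bsubdiff_posdef x V : bsubdiff P x V -> forall v,
  dotp v (T *m v) <= dotp v ((V + T) *m v).
Proof.
move=> dV v; rewrite mulmxDl dotpDr lerDr dotpC.
exact: le_trans (dotp_ge0 _) (bsubdiff_mproj_firm v dV).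
Qed.

Lemma newton_matrix_unit x V : bsubdiff P x V -> V + T \in unitmx.
Proof.
move=> dV; apply: posdef_unit => v /T_posdef v0.
exact: lt_le_trans v0 (bsubdiff_posdef dV v).
Qed.

(* [V d] and [P y - P x] both lie in the ball having [0] and [d = y - x] as
   antipodal points. *)
Lemma bsubdiff_mproj_remainder x y V : bsubdiff P x V ->
  enorm (V *m (y - x) - (P y - P x)) <= enorm (y - x).
Proof.
move=> dV; have h1 := bsubdiff_mproj_firm (y - x) dV; have h2 := mproj_firm y x.
move: (y - x) (P y - P x) (V *m (y - x)) h1 h2 => d w v h1 h2.
(* Membership in the ball of center d / 2 and radius |d| / 2, scaled by 2. *)
have ball (z : 'cV[R]_m.+1) : dotp z z <= dotp z d ->
    enorm (2 *: z - d) <= enorm d.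
  move=> zd; rewrite enorm_le !dotp_lin (dotpC d z); lra.
have -> : v - w = 2^-1 *: ((2 *: v - d) + - (2 *: w - d)).
  by apply/matrixP => i j; rewrite !mxE; field.
rewrite enormZ ger0_norm ?invr_ge0 //.
have := enormD (2 *: v - d) (- (2 *: w - d)); rewrite enormN.
by have := ball _ h1; have := ball _ h2; lra.
Qed.

Lemma newton_step_contraction b xs x y :
  P xs + T *m xs = b -> newton_step T b x y ->
  enorm (xs - y) <= opnorm (invmx T) * enorm (xs - x).
Proof.
move=> xsE [V dV Vy].
have [->|e0] := eqVneq (xs - y) 0.
  by rewrite enorm0 (le_trans (enorm_ge0 _) (enorm_mulmx_le _ _)).
have ne : 0 < enorm (xs - y) by rewrite lt_def enorm_eq0 e0 enorm_ge0.
have gE : (V + T) *m (xs - y) = V *m (xs - x) - (P xs - P x).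
  rewrite mulmxBr Vy -xsE -(bsubdiff_mproj_self dV) mulmxDl mulmxBr.
  by apply/matrixP => i j; rewrite !mxE; ring.
have r0 : 0 <= opnorm (invmx T).
  rewrite -(pmulr_lge0 _ ne).
  exact: le_trans (enorm_ge0 _) (enorm_mulmx_le _ _).
(* With e = xs - y and r = |T^-1|, the chain is |e|^2 <= r <e, T e> <= r <e, (V + T) e> <= r |e| |(V
   + T) e| <= r |e| |xs - x|; then |e| cancels. *)
have le1 := posdef_dotp_ge (xs - y) T_sym T_posdef.
have le2 := ler_wpM2l r0 (bsubdiff_posdef dV (xs - y)).
have le3 := ler_wpM2l r0 (dotp_le_enorm (xs - y) ((V + T) *m (xs - y))).
have le4 := bsubdiff_mproj_remainder xs dV; rewrite -gE in le4.
rewrite -(ler_pM2l ne) -expr2 enorm_sqr mulrCA.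
apply: (le_trans le1); apply: (le_trans le2); apply: (le_trans le3).
by rewrite ler_wpM2l // ler_wpM2l // ltW.
Qed.

End Solution.

(** * Convergence from the linear rate, and the theorem *)

Lemma cvg_of_geometric_bound (R : realType) (n : nat) (r : R)
    (x : nat -> 'cV[R]_n) (a : 'cV[R]_n) :
  r < 1 -> (forall k, enorm (a - x k.+1) <= r * enorm (a - x k)) ->
  x @ \oo --> a.
Proof.
move=> r1 step.
(* A negative rate forces every term after the first to equal [a]; the geometric bound needs r >= 0
   for its induction. *)
have [r0|r0] := ltP r 0.
  have x0 k : x k.+1 = a.
    apply/esym/eqP; rewrite -subr_eq0 -enorm_eq0 eq_le enorm_ge0 andbT.
    by rewrite (le_trans (step k)) // mulr_le0_ge0 ?enorm_ge0 // ltW.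
  rewrite -cvg_shiftS.
  have -> : (fun k => x k.+1) = fun=> a by apply/funext => k; exact: x0.
  exact: cvg_cst.
have bound k : enorm (a - x k) <= enorm (a - x 0%N) * r ^+ k.
  elim: k => [|k IH]; first by rewrite expr0 mulr1.
  by rewrite (le_trans (step k)) // exprS mulrCA ler_wpM2l.
have geo : (fun k => enorm (a - x 0%N) * r ^+ k) @ \oo --> 0.
  rewrite -(mulr0 (enorm (a - x 0%N))); apply: cvgM; first exact: cvg_cst.
  by apply: cvg_expr; rewrite ger0_norm.
apply: cvg_enorm0; apply: squeeze_cvgr (cvg_cst 0) geo.
apply: nearW => k; rewrite enorm_ge0 /= (le_trans _ (bound k)) //.
by rewrite -enormN opprB.
Qed.

Theorem theorem3 (R : realType) (m : nat) (b : 'cV[R]_m.+1) (T : 'M[R]_m.+1)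
    (T_sym : sym_mx T) (T_posdef : posdef_mx T) :
  exists xs : 'cV[R]_m.+1,
    [/\ mproj (@soc R m) xs + T *m xs = b,
        forall x : 'cV[R]_m.+1, mproj (@soc R m) x + T *m x = b -> x = xs,
        forall x0 : 'cV[R]_m.+1, newton_well_defined T b x0 &
        opnorm (invmx T) < 1 ->
        forall (x0 : 'cV[R]_m.+1) (x : nat -> 'cV[R]_m.+1),
          newton_seq T b x0 x ->
          x @ \oo --> xs /\
          forall k : nat,
            enorm (xs - x k.+1) <= opnorm (invmx T) * enorm (xs - x k)].
Proof.
have [xs xsE] := mproj_equation_solvable T_sym T_posdef b.
exists xs; split=> //.
- by move=> x xE; apply: (mproj_equation_unique T_posdef); rewrite xE.
- move=> x0 N x _; split; first exact: bsubdiff_mproj_nonempty.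
  by move=> V; exact: newton_matrix_unit.
- move=> T1 x0 x [_ xstep].
  have rate k := newton_step_contraction T_sym T_posdef xsE (xstep k).
  by split=> //; exact: cvg_of_geometric_bound T1 rate.
Qed.
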